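(* Let $m>n$ and fix $\lambda,\mu>0$. Every refutation of $\mathrm{BinPHP}^m_n$ in $\mathrm{Res}(\sqrt{2}\log^{\frac{1}{2+\lambda}}n)$ has size $2^{\Omega(n^{1-\mu})}$.
   Context: $n$ is a power of 2; for a hole $a\in[n]$, $a_1\dots a_{\log n}$ is its binary representation; $\omega^1=\omega$, $\omega^0=\neg\omega$. $\mathrm{BinPHP}^m_n$ has variables $\omega_{i,\ell}$ ($i\in[m]$ pigeons, $\ell\in[\log n]$) and, for all $i\neq i'\in[m]$, $a\in[n]$, the clause $\bigvee_{\ell}\omega_{i,\ell}^{1-a_\ell}\vee\bigvee_\ell\omega_{i',\ell}^{1-a_\ell}$. For an integer $s\ge 1$ (here $s=\sqrt2\log^{1/(2+\lambda)}n$, rounded to an integer), $\mathrm{Res}(s)$ is the refutation system whose lines are $s$-DNFs, with rules: $\wedge$-introduction (from $\mathcal{D}_1\vee\bigwedge_{J_1}l_j$ and $\mathcal{D}_2\vee\bigwedge_{J_2}l_j$ derive $\mathcal{D}_1\vee\mathcal{D}_2\vee\bigwedge_{J_1\cup J_2}l_j$ if $|J_1\cup J_2|\le s$), cut (from $\mathcal{D}_1\vee\bigvee_{J}l_j$ and $\mathcal{D}_2\vee\bigwedge_J\neg l_j$ derive $\mathcal{D}_1\vee\mathcal{D}_2$), weakening (from $\mathcal{D}$ derive $\mathcal{D}\vee\bigwedge_J l_j$, $|J|\le s$; from $\mathcal{D}\vee\bigwedge_{J_1\cup J_2}l_j$ derive $\mathcal{D}\vee\bigwedge_{J_1}l_j$).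 Size = number of rule applications; asymptotics as $n\to\infty$. *)

(* Defs.v *)
From mathcomp Require Import all_boot.

Set Implicit Arguments.
Unset Strict Implicit.
Unset Printing Implicit Defensive.

Local Open Scope nat_scope.

Section Res.
Variable V : finType.

(* (v, b) is the literal v^b: v if b = true, the negation of v if b = false. *)
Definition neg (l : V * bool) : V * bool := (l.1, ~~ l.2).

(* A term is the conjunction of its literals and a DNF the disjunction of its
   terms.  Set union is disjunction of DNFs and set0 is the empty (false) DNF;
   contradictory terms are not excluded. *)
Definition term := {set V * bool}.
Definition dnf := {set {set V * bool}}.

Definition is_sdnf (s : nat) (D : dnf) : bool := [forall T in D, #|T| <= s].

Definition disj (J : {set V * bool}) : dnf := [set [set l] | l in J].

Inductive res_rule (s : nat) (avail : pred dnf) : dnf -> Prop :=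
| and_intro (D1 D2 : dnf) (J1 J2 : term) of
    avail (D1 :|: [set J1]) & avail (D2 :|: [set J2]) & #|J1 :|: J2| <= s :
    res_rule s avail (D1 :|: D2 :|: [set J1 :|: J2])
| cut (D1 D2 : dnf) (J : term) of
    avail (D1 :|: disj J) & avail (D2 :|: [set neg @: J]) :
    res_rule s avail (D1 :|: D2)
| weaken_add (D : dnf) (J : term) of avail D & #|J| <= s :
    res_rule s avail (D :|: [set J])
| weaken_term (D : dnf) (J1 J2 : term) of avail (D :|: [set J1 :|: J2]) :
    res_rule s avail (D :|: [set J1]).

(* The DNFs usable as premises: clauses of F and previously derived lines. *)
Definition available (F : {set {set V * bool}}) (pi : seq dnf) : pred dnf :=
  fun D => (D \in [set disj C | C in F]) || (D \in pi).

(* pi lists the conclusions of the successive rule applications, the clauses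
   of F being usable at no cost; hence size pi is the number of rule
   applications.  Lines may be reused (dag-like refutations). *)
Definition res_refutation (s : nat) (F : {set {set V * bool}}) (pi : seq dnf)
    : Prop :=
  [/\ forall i, i < size pi ->
        res_rule s (available F (take i pi)) (nth set0 pi i),
      all (is_sdnf s) pi
    & available F pi set0].

End Res.

(* The l-th of the k binary digits of a, most significant digit first; the
   n = 2 ^ k holes are numbered from 0. *)
Definition bit (k : nat) (a : 'I_(2 ^ k)) (l : 'I_k) : bool :=
  odd (a %/ 2 ^ (k.-1 - l)).

(* Clauses are sets of literals over the variables (pigeon, bit position). *)
Definition binphp_clause (m k : nat) (i i' : 'I_m) (a : 'I_(2 ^ k)) :
    {set ('I_m * 'I_k) * bool} :=
  [set ((i, l), ~~ bit a l) | l : 'I_k] :|: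
  [set ((i', l), ~~ bit a l) | l : 'I_k].

(* BinPHP^m_n with n = 2 ^ k. *)
Definition binphp (m k : nat) : {set {set ('I_m * 'I_k) * bool}} :=
  [set C | [exists i : 'I_m, exists i' : 'I_m, exists a : 'I_(2 ^ k),
              (i != i') && (C == binphp_clause i i' a)]].

(* Main.v *)
(** A random restriction sets, for every pigeon independently, few of its [k]
    bits.  In each of [s] rounds a line with many terms on disjoint sets of
    pigeons becomes true with overwhelming probability, independently of the
    number of pigeons, and any other line has a small set of pigeons meeting all
    its terms; placing these pigeons in holes shortens every term, and the next
    round beats the union bound over all placements.  After [s] rounds each
    pigeon has at most [s^2] bits set, hence still [2^(k - s^2)] holes, and each
    line is decided by placing [(1 + log |pi|) * (2k)^O(s^2)] pigeons.  If this
    is well below [2^(k - s^2)], then by induction along the refutation no line,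
    in particular not the empty one, can be falsified by a small matching.  Since
    [s^2 log k = o(k)], a refutation has [log |pi| >= 2^(k - o(k))]. *)
Require Import Defs.
From mathcomp Require Import all_boot all_order all_algebra.
From mathcomp Require Import boolp ring lra zify.

Set Implicit Arguments.
Unset Strict Implicit.
Unset Printing Implicit Defensive.

Import Order.TTheory GRing.Theory Num.Theory.

Local Open Scope nat_scope.

(** * Counting and probability over product spaces *)

Lemma card_ffun_forall (I W : finType) (P : I -> pred W) :
  #|[set f : {ffun I -> W} | [forall i, P i (f i)]]| = \prod_i #|P i|.
Proof.
under eq_bigr => i _ do rewrite -sum1_card big_mkcond /=.
rewrite bigA_distr_bigA /= -sum1_card big_mkcond /=.
apply: eq_bigr => f _; rewrite inE; case: forallP => [Pf|/forallP].
  by rewrite big1 // => i _; rewrite ifT //; exact: Pf.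
rewrite negb_forall => /existsP[i /negPf Pi].
by rewrite (bigD1 i) //= unfold_in Pi mul0n.
Qed.

Section Independence.
Local Open Scope ring_scope.

Lemma prod_sub_expand (F : comPzRingType) (I : finType) (x : I -> F) :
  \prod_i (1 - x i) = \sum_(J in {set I}) (-1) ^+ #|J| * \prod_(i in J) x i.
Proof.
under eq_bigr => i _ do rewrite addrC.
rewrite bigA_distr /=; apply: eq_bigr => J _.
rewrite -prodr_const -big_split /= [RHS]big_mkcond /=; apply: eq_bigr => i _.
by case: ifP; rewrite ?mulN1r.
Qed.

(* Inclusion-exclusion turns both sides into sums of products over the
   coordinates, so no conditioning is needed. *)
Lemma sum_prod_indep (F : numFieldType) (I W : finType) (c : nat)
    (S : 'I_c -> {set I}) (A : 'I_c -> I -> pred W) :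
  (0 < #|W|)%N -> (forall j j', j != j' -> [disjoint S j & S j']) ->
  \sum_(w : {ffun I -> W})
      \prod_j (1 - \prod_(i in S j) (A j i (w i))%:R) =
  #|W|%:R ^+ #|I| * \prod_j (1 - \prod_(i in S j) (#|A j i|%:R / #|W|%:R)) :> F.
Proof.
move=> W0 dS; have nW : #|W|%:R != 0 :> F by rewrite pnatr_eq0 -lt0n.
under [LHS]eq_bigr => w _ do
  rewrite (prod_sub_expand (fun j => \prod_(i in S j) (A j i (w i))%:R)).
rewrite (prod_sub_expand (fun j => \prod_(i in S j) (#|A j i|%:R / #|W|%:R))) exchange_big mulr_sumr /=; apply: eq_bigr => J _.
rewrite -mulr_sumr mulrCA; congr (_ * _).
have ex G : \prod_(j in J) \prod_(i in S j) G j i =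
    \prod_i \prod_(j in J | i \in S j) G j i :> F.
  by rewrite (exchange_big_dep predT).
under [LHS]eq_bigr => w _ do rewrite (ex (fun j i => (A j i (w i))%:R)).
rewrite -(bigA_distr_bigA (fun i x => \prod_(j in J | i \in S j) (A j i x)%:R)).
rewrite (ex (fun j i => #|A j i|%:R / #|W|%:R)).
rewrite -prodr_const -big_split /=; apply: eq_bigr => i _.
(* The sets [S j] are disjoint, so each coordinate occurs in at most one of them and contributes a
   single indicator, or the constant 1. *)
case: (pickP (fun j => (j \in J) && (i \in S j))) => [j /andP[jJ iS]|no]; last first.
  rewrite (eq_bigr (fun=> 1)) => [|x _]; last by rewrite big_pred0.
  by rewrite [X in _ = _ * X]big_pred0 // mulr1 sumr_const cardT.
have one j' : (j' \in J) && (i \in S j') = (j' == j).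
  apply/idP/eqP => [/andP[_ iS']|->]; last by rewrite jJ.
  apply/eqP; case: eqP => // /eqP /dS /pred0P/(_ i) /=.
  by rewrite iS iS'.
rewrite (eq_bigr (fun x => (A j i x)%:R)) => [|x _]; last by rewrite (big_pred1 j).
rewrite [X in _ = _ * X](big_pred1 j) // mulrC divfK // -natr_sum -sum1_card big_mkcond /=.
by congr (_%:R); rewrite [RHS]big_mkcond; apply: eq_bigr => x _; rewrite unfold_in; case: (A j i x).
Qed.

(** Union bound: by independence, all [q * L.+1] events of a given [t] fail with probability at most
    [(1 - 1/q)^(q(L+1)) <= 2^-(L+1)], so some [t] fails with probability at most 1/2. *)
Lemma exists_satisfying_all (I W : finType) (T : finType) (q L : nat)
    (S : T -> 'I_(q * L.+1) -> {set I})
    (A : T -> 'I_(q * L.+1) -> I -> pred W) :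
  (0 < #|W|)%N -> (0 < q)%N -> (#|T| <= 2 ^ L)%N ->
  (forall t j j', j != j' -> [disjoint S t j & S t j']) ->
  (forall t j, q%:R^-1 <= \prod_(i in S t j) (#|A t j i|%:R / #|W|%:R) :> rat) ->
  exists w : {ffun I -> W}, forall t, exists j,
    forall i, i \in S t j -> A t j i (w i).
Proof.
move=> W0 q0 cT dS lb.
pose f t (w : {ffun I -> W}) : rat :=
  \prod_j (1 - \prod_(i in S t j) (A t j i (w i))%:R).
have fE t w : f t w = (~~ [exists j, [forall (i | i \in S t j), A t j i (w i)]])%:R.
  have pE j : \prod_(i in S t j) (A t j i (w i))%:R =
      [forall (i | i \in S t j), A t j i (w i)]%:R :> rat.
    case: (boolP [forall (i | i \in S t j), A t j i (w i)]) => [/forall_inP h|].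
      by rewrite big1 // => i /h ->.
    rewrite negb_forall => /existsP[i]; rewrite negb_imply => /andP[iS /negPf nA].
    by rewrite (bigD1 i) //= nA mul0r.
  rewrite /f; under eq_bigr => j _ do rewrite pE.
  case: existsP => [[j Hj]|no]; first by rewrite (bigD1 j) //= Hj subrr mul0r.
  rewrite big1 // => j _; case: (boolP [forall (i | _), _]) => [Hj|_].
    by case: no; exists j.
  by rewrite subr0.
apply: contrapT => bad.
have ge1 w : 1 <= \sum_t f t w.
  have [t ht] : exists t, f t w = 1.
    apply: contrapT => no; apply: bad; exists w => t.
    have := no; move/forallNP/(_ t); rewrite fE.
    case: existsP => //= -[j /forall_inP Hj] _; by exists j.
  rewrite (bigD1 t) //= ht lerDl sumr_ge0 // => t' _.
  by rewrite fE ler0n.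
have WI : 0 < #|W|%:R ^+ #|I| :> rat by rewrite exprn_gt0 // ltr0n.
have : \sum_(w : {ffun I -> W}) 1 <= \sum_w \sum_t f t w by exact: ler_sum.
rewrite sumr_const card_ffun exchange_big /= => le1.
have q1 : q%:R^-1 <= 1 :> rat by rewrite invf_le1 ?ltr0n // ler1n.
(* Bernoulli's inequality for [(1 - 1/q)^-1 = 1 + 1/(q-1)]; the case [q = 1] is separate because
   [q - 1] then vanishes. *)
have half : (1 - q%:R^-1) ^+ q <= 2^-1 :> rat.
  have [->|q_neq1] := eqVneq q 1%N; first by rewrite invr1 subrr expr1.
  have q2 : (1 < q)%N by rewrite ltn_neqAle eq_sym q_neq1.
  have xgt0 : 0 < 1 - q%:R^-1 :> rat by rewrite subr_gt0 invf_lt1 ?ltr0n // ltr1n.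
  rewrite -[leLHS]invrK lef_pV2 ?posrE ?invr_gt0 ?exprn_gt0 // -exprVn.
  have -> : (1 - q%:R^-1)^-1 = 1 + (q.-1%:R)^-1 :> rat.
    have q0' : q%:R != 0 :> rat by rewrite pnatr_eq0 -lt0n.
    have e : q%:R = 1 + q.-1%:R :> rat by rewrite nat1r prednK.
    have qn : q.-1%:R != 0 :> rat by rewrite pnatr_eq0 -lt0n -subn1 subn_gt0.
    by rewrite e; field; rewrite qn -e.
  have bern (y : rat) n : 0 <= y -> 1 + y *+ n <= (1 + y) ^+ n.
    move=> y0; elim: n => [|n IH]; first by rewrite mulr0n addr0 expr0.
    rewrite exprS; apply: le_trans (ler_wpM2l _ IH); last by rewrite addr_ge0.
    have : 0 <= y * (y *+ n) by rewrite mulr_ge0 // mulrn_wge0.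
    rewrite mulrS; lra.
  apply: le_trans (bern _ q _); last by rewrite invr_ge0 ler0n.
  rewrite -{1}[2]/(1 + 1) lerD2l -[leRHS]mulr_natl ler_pdivlMr ?ltr0n -?subn1 ?subn_gt0 //.
  by rewrite mul1r ler_nat leq_subr.
have up t : \sum_w f t w <= #|W|%:R ^+ #|I| * (2^-1) ^+ L.+1.
  rewrite /f sum_prod_indep //; last exact: dS.
  rewrite ler_wpM2l ?(ltW WI) //.
  have prod_le1 j : \prod_(i in S t j) (#|A t j i|%:R / #|W|%:R) <= 1 :> rat.
    apply: prodr_ile1 => i _; rewrite divr_ge0 ?ler0n //=.
    by rewrite ler_pdivrMr ?ltr0n // mul1r ler_nat max_card.
  apply: le_trans (_ : \prod_(j < q * L.+1) (1 - q%:R^-1) <= _).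
    apply: ler_prod => j _; rewrite subr_ge0 prod_le1 /=.
    by rewrite lerD2l lerN2 lb.
  rewrite prodr_const card_ord exprM lerXn2r ?nnegrE ?invr_ge0 //.
  by rewrite exprn_ge0 // subr_ge0.
have : \sum_t \sum_w f t w <= \sum_(t : T) #|W|%:R ^+ #|I| * (2^-1) ^+ L.+1.
  by apply: ler_sum => t _; exact: up.
rewrite sumr_const => /(le_trans le1).
rewrite natrX -[leLHS]mulr1 -mulrnAr ler_pM2l // leNgt => /negP; apply.
rewrite -mulr_natl; apply: le_lt_trans (_ : 2 ^+ L * 2^-1 ^+ L.+1 < _).
  by rewrite ler_wpM2r ?exprn_ge0 ?invr_ge0 // -natrX ler_nat.
by rewrite exprS mulrCA -exprMn divff // expr1n mulr1 invf_lt1 // ltr1n.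
Qed.

End Independence.

Lemma card_agree (k : nat) (X : {set 'I_k}) (y : 'I_k -> bool) :
  #|[set v : {ffun 'I_k -> bool} | [forall l, (l \in X) ==> (v l == y l)]]|
    * 2 ^ #|X| = 2 ^ k.
Proof.
rewrite (card_ffun_forall (fun l x => (l \in X) ==> (x == y l))).
rewrite -prod_nat_const [in X in _ * X]big_mkcond /= -big_split /=.
rewrite -[in RHS](card_ord k) -prod_nat_const; apply: eq_bigr => l _.
case: ifP => _; last by rewrite muln1 -card_bool; apply: eq_card.
by rewrite -[RHS]mul1n -(card1 (y l)); congr (_ * _); apply: eq_card.
Qed.

(** It suffices that, for each [j < #|X|], draw [j] is the [j]-th element of [X]; the other draws
    stay free. *)
Lemma card_hit (k s : nat) (X : {set 'I_k}) : #|X| <= s ->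
  k ^ s <= #|[set u : {ffun 'I_s -> 'I_k} | [forall l in X, l \in codom u]]|
    * k ^ #|X|.
Proof.
move=> Xs; pose P (j : 'I_s) (x : 'I_k) := (j < #|X|) ==> (nth x (enum X) j == x).
apply: (@leq_trans (#|[set u : {ffun 'I_s -> 'I_k} | [forall j, P j (u j)]]| * k ^ #|X|)).
  have -> : k ^ #|X| = \prod_(j < s) (if j < #|X| then k else 1).
    by rewrite -big_mkcond -(big_ord_widen s (fun=> k) Xs) prod_nat_const card_ord.
  rewrite card_ffun_forall -big_split /= -[X in k ^ X](card_ord s) -prod_nat_const.
  apply: leq_prod => j _.
  case: ifP => jX; last first.
    by rewrite muln1 -[X in X <= _](card_ord k); apply/subset_leq_card/subsetP => x _; rewrite unfold_in /= /P jX.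
  rewrite leq_pmull //; apply/card_gt0P.
  have /card_gt0P[x0 _] := leq_ltn_trans (leq0n _) jX.
  exists (nth x0 (enum X) j); rewrite unfold_in /= /P jX /=.
  by apply/eqP/set_nth_default; rewrite -cardE.
rewrite leq_mul2r; apply/orP; right; apply/subset_leq_card/subsetP => u.
rewrite !inE => /forallP Pu; apply/forall_inP => l lX.
have jX : index l (enum X) < #|X| by rewrite cardE index_mem mem_enum.
have := Pu (Ordinal (leq_trans jX Xs)); rewrite /P /= jX /= nth_index ?mem_enum //.
by move=> /eqP ->; exact: codom_f.
Qed.

(** * Partial assignments *)

Section Assignments.
Variable V : finType.
Implicit Types (U : {set V}) (b : V -> bool) (T : term V) (D : dnf V).

Definition agree U b b' := {in U, b =1 b'}.

Definition sat_term b T := [forall l in T, b l.1 == l.2].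

Definition sat_dnf b D := [exists T in D, sat_term b T].

Lemma sat_termP b T : reflect (forall l, l \in T -> b l.1 = l.2) (sat_term b T).
Proof. by apply: (iffP forall_inP) => h l /h /eqP. Qed.

Lemma agree_trans U b1 b2 b3 : agree U b1 b2 -> agree U b2 b3 -> agree U b1 b3.
Proof. by move=> h1 h2 v vU; rewrite h1 // h2. Qed.

Lemma agreeS U1 U2 b1 b2 : U1 \subset U2 -> agree U2 b1 b2 -> agree U1 b1 b2.
Proof. by move=> /subsetP sU h v /sU /h. Qed.

End Assignments.

Section Pigeons.
Variables m k : nat.
Local Notation V := ('I_m * 'I_k)%type.
Local Notation hole := {ffun 'I_k -> bool}.
Implicit Types (U : {set V}) (b g : V -> bool) (T : term V) (D : dnf V).
Implicit Types (A P Q : {set 'I_m}).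

Definition cols A : {set V} := [set v | v.1 \in A].

Definition row_of U (i : 'I_m) : {set 'I_k} := [set l | (i, l) \in U].

Definition hole_of g (i : 'I_m) : hole := [ffun l => g (i, l)].

Definition matching A g := {in A &, injective (hole_of g)}.

Definition residual U A T : {set V * bool} :=
  [set l in T | (l.1 \notin U) && (l.1.1 \notin A)].

Definition pigeons (X : {set V * bool}) : {set 'I_m} := [set l.1.1 | l in X].

(* The partial assignment setting the variables in [U] as [b] does, and all bits
   of the pigeons in [A] as [g] does, is handled through its total extensions. *)
Definition extends U b A g (y : V -> bool) := agree U b y /\ agree (cols A) g y.

Definition decided U b A g D :=
  (forall y, extends U b A g y -> sat_dnf y D) \/
  (forall y, extends U b A g y -> ~~ sat_dnf y D).

(* [A] and [g] fix the holes of some pigeons.  Whatever further matching [P] an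
   adversary holds, [h] more pigeons decide [D], and they do so without [P];
   this plays the role of a decision tree of height [h] for [D]. *)
Definition determined (M h : nat) U b A g D :=
  forall P g1, A \subset P -> extends U b A g g1 -> matching P g1 ->
    #|P| + h <= M ->
  exists (E : {set 'I_m}) g2, [/\ #|E| <= h, extends U b P g1 g2, matching (P :|: E) g2
    & decided U b (A :|: E) g2 D].

Lemma colsS A P : A \subset P -> cols A \subset cols P.
Proof. by move=> /subsetP h; apply/subsetP => v; rewrite !inE => /h. Qed.

Lemma hole_of_agree A g g' i : agree (cols A) g g' -> i \in A ->
  hole_of g i = hole_of g' i.
Proof. by move=> h iA; apply/ffunP => l; rewrite !ffunE h // inE. Qed.

(** With at most [t] bits fixed, pigeon [i] has at least [2 ^ (k - t)] compatible holes, more than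
    [P] can occupy. *)
Lemma extend_matching1 t U b P g i :
  #|row_of U i| <= t -> #|P| < 2 ^ (k - t) ->
  agree U b g -> matching P g ->
  exists g', extends U b P g g' /\ matching (i |: P) g'.
Proof.
move=> rowU Pt bg mP; have [iP|iP] := boolP (i \in P).
  by exists g; split=> //; rewrite (setUidPr _) // sub1set.
pose C := [set v : hole | [forall l, (l \in row_of U i) ==> (v l == b (i, l))]].
have C_large : 2 ^ (k - t) <= #|C|.
  have cE := card_agree (row_of U i) (fun l => b (i, l)).
  rewrite -(@leq_pmul2r (2 ^ #|row_of U i|)) ?expn_gt0 // cE -expnD leq_exp2l //.
  have : #|row_of U i| <= k by rewrite -[X in _ <= X]card_ord max_card.
  lia.
have [v vC vP] : exists2 v, v \in C & v \notin hole_of g @: P.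
  apply/subsetPn; apply/negP => /subset_leq_card.
  by rewrite leqNgt (leq_ltn_trans (leq_imset_card _ _)) // (leq_trans Pt).
pose g' (x : V) := if x.1 == i then v x.2 else g x.
have g'E j : j != i -> hole_of g' j = hole_of g j.
  by move=> /negPf ji; apply/ffunP => l; rewrite !ffunE /g' /= ji.
have g'i : hole_of g' i = v by apply/ffunP => l; rewrite ffunE /g' /= eqxx.
exists g'; split; first split.
- move=> [j l] U_jl; rewrite /g' /=; case: eqP => [ji|_]; last exact: bg.
  subst j; move: vC; rewrite inE => /forallP/(_ l); rewrite inE U_jl /=.
  by move/eqP.
- move=> [j l]; rewrite inE /g' /= => jP; case: eqP => // ji.
  by rewrite -ji jP in iP.
have neP j : j \in P -> j != i by move=> jP; apply: contraNneq iP => <-.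
move=> j j' /setU1P[->|jP] /setU1P[->|j'P] //.
- rewrite g'i g'E ?neP // => e; case/negP: vP; rewrite e; exact: imset_f.
- rewrite g'i g'E ?neP // => e; case/negP: vP; rewrite -e; exact: imset_f.
by rewrite !g'E ?neP //; apply: mP.
Qed.

Lemma extend_matching t U b P Q g :
  (forall i, #|row_of U i| <= t) -> #|P| + #|Q| <= 2 ^ (k - t) ->
  agree U b g -> matching P g ->
  exists g', extends U b P g g' /\ matching (P :|: Q) g'.
Proof.
move=> rowU; have [n] := ubnP #|Q|; elim: n => // n IH in Q P g *.
have [->|[i iQ]] := set_0Vmem Q.
  by move=> _ _ bg mP; exists g; split=> //; rewrite setU0.
rewrite (cardsD1 i Q) iQ => Qn PQ bg mP.
have [|g1 [[bg1 gg1] m1]] := extend_matching1 (rowU i) _ bg mP; first by lia.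
have cU : #|i |: P| <= #|P|.+1 by rewrite cardsU1; case: (i \in P); lia.
have [||||g2 [[bg2 gg2] m2]] := IH (Q :\ i) (i |: P) g1 => //; try by lia.
exists g2; split; last by rewrite -(setD1K iQ) setUA [P :|: _]setUC.
by split=> //; apply: agree_trans gg1 (agreeS _ gg2); apply/colsS/subsetUr.
Qed.

(** Falsified and contradictory terms are excluded: no extension makes them true, so residual bounds
    and covers concern the remaining terms. *)
Definition alive U b A g D T :=
  T \in D /\ exists2 y, extends U b A g y & sat_term y T.

Lemma residualS U U' A A' T : U \subset U' -> A \subset A' ->
  residual U' A' T \subset residual U A T.
Proof.
move=> /subsetP sU /subsetP sA; apply/subsetP => l; rewrite !inE.
by case/and3P=> -> /(contra (sU _)) -> /(contra (sA _)) ->.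
Qed.

Lemma extendsW U U' b b' A A' g g' y :
  U \subset U' -> agree U b b' -> A \subset A' -> agree (cols A) g g' ->
  extends U' b' A' g' y -> extends U b A g y.
Proof.
move=> sU bb sA gg [h1 h2]; split.
  exact: agree_trans bb (agreeS sU h1).
exact: agree_trans gg (agreeS (colsS sA) h2).
Qed.

(* A term all of whose variables are set needs no special treatment: its
   residual is empty, hence disjoint from itself, and it may be repeated. *)
Lemma disjoint_or_cover U b A g D s :
  (forall T, alive U b A g D T -> #|residual U A T| <= s) -> forall c,
  (exists T : nat -> term V,
     (forall j, j < c -> alive U b A g D (T j)) /\
     (forall j j', j < j' < c ->
        [disjoint pigeons (residual U A (T j)) & pigeons (residual U A (T j'))])) \/
  (exists Q, #|Q| <= s * c /\ forall T, alive U b A g D T ->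
     ~~ [disjoint pigeons (residual U A T) & Q]).
Proof.
move=> res_s; elim=> [|c [[T [aT dT]]|[Q [cQ cov]]]]; last first.
- by right; exists Q; split=> //; apply: leq_trans cQ _; rewrite leq_mul2l leqnSn orbT.
(* Greedy choice: either the pigeons of the terms found so far meet every alive term, or an alive
   term avoiding them prolongs the family. *)
- pose Q := \bigcup_(j < c) pigeons (residual U A (T j)).
  have cQ : #|Q| <= s * c.
    rewrite mulnC -[c in X in _ <= X]card_ord -sum_nat_const.
    rewrite /Q; elim/big_ind2: _ => [|S1 n1 S2 n2 h1 h2|j _]; first by rewrite cards0.
      by apply: leq_trans (leq_card_setU _ _) (leq_add h1 h2).
    exact: leq_trans (leq_imset_card _ _) (res_s _ (aT _ _)).
  have [cov|/existsNP[T1 /not_implyP[aT1 /negP]]] :=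
    EM (forall T, alive U b A g D T -> ~~ [disjoint pigeons (residual U A T) & Q]).
    by right; exists Q; split=> //; apply: leq_trans cQ _; rewrite leq_mul2l leqnSn orbT.
  rewrite negbK => dQ; left; exists (fun j => if j == c then T1 else T j); split.
    by move=> j; case: eqP => // /eqP jc jc'; apply: aT; lia.
  move=> j j' /andP[jj' j'c]; have jc : j < c by lia.
  rewrite (ltn_eqF jc); case: eqP => [_|/eqP nj']; last by apply: dT; lia.
  rewrite disjoint_sym; apply: disjointWr dQ.
  exact: (bigcup_sup (Ordinal jc)).
by left; exists (fun=> set0); split=> // j j'; rewrite ltn0 andbF.
Qed.

(* Each pigeon independently receives a random total assignment of its bits, of
   which only [s] positions, drawn at random with repetition, are kept.  A
   residual of size at most [s] is then satisfied with probability at least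
   [(2k)^-s], whatever the number of pigeons it touches. *)
Lemma satisfy_disjoint_terms (J : finType) (A : J -> {set 'I_m}) (g : J -> V -> bool)
    (U : {set V}) b s L (T : J -> 'I_((2 * k) ^ s * L.+1) -> term V)
    (y : J -> 'I_((2 * k) ^ s * L.+1) -> V -> bool) :
  0 < k -> #|J| <= 2 ^ L ->
  (forall x j, extends U b (A x) (g x) (y x j)) ->
  (forall x j, sat_term (y x j) (T x j)) ->
  (forall x j, #|residual U (A x) (T x j)| <= s) ->
  (forall x j j', j != j' -> [disjoint pigeons (residual U (A x) (T x j))
                                & pigeons (residual U (A x) (T x j'))]) ->
  exists U' b', [/\ U \subset U', agree U b b',
    forall i, #|row_of U' i| <= #|row_of U i| + s &
    forall x, exists j, forall z,
      extends U' b' (A x) (g x) z -> sat_term z (T x j)].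
Proof.
move=> k0 cJ ext_y sat_y res_s dis.
pose W : finType := ({ffun 'I_s -> 'I_k} * hole)%type.
pose Z x j : {set V} := [set l.1 | l in residual U (A x) (T x j)].
have Zs x j : #|Z x j| <= s by apply: leq_trans (leq_imset_card _ _) (res_s x j).
pose X x j i := row_of (Z x j) i.
(* Pigeon [i] succeeds when its drawn positions cover its part of the residual and its random bits
   agree there with the satisfying assignment. *)
pose ok x j i (w : W) :=
  [forall l in X x j i, l \in codom w.1] &&
  [forall l, (l \in X x j i) ==> (w.2 l == y x j (i, l))].
have cW : #|W| = k ^ s * 2 ^ k by rewrite card_prod !card_ffun !card_ord card_bool.
have W0 : 0 < #|W| by rewrite cW muln_gt0 !expn_gt0 k0.
have sumX x j : \sum_(i in pigeons (residual U (A x) (T x j))) #|X x j i| <= s.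
  apply: leq_trans (Zs x j); under eq_bigr => i _ do rewrite -sum1_card.
  rewrite pair_big_dep /= -sum1_card [leqRHS]big_mkcond [leqLHS]big_mkcond /=.
  apply: leq_sum => -[i l] _ /=; rewrite inE.
  by case: (_ \in Z x j); rewrite ?andbF //; case: ifP.
have Xs x j i : #|X x j i| <= s.
  have inj_i : injective (pair i : 'I_k -> V) by move=> l l' [].
  apply: leq_trans (Zs x j); rewrite -(card_imset _ inj_i).
  by apply/subset_leq_card/subsetP => _ /imsetP[l + ->]; rewrite inE.
(* Covering has probability at least [k^-|X|] and agreement exactly [2^-|X|]; over all pigeons these
   exponents add up to at most [s]. *)
have ok_large x j i : #|W| <= #|ok x j i| * (2 * k) ^ #|X x j i|.
  have <- : #|[set w | ok x j i w]| = #|ok x j i| by rewrite cardsE.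
  pose Hit := [set u : {ffun 'I_s -> 'I_k} | [forall l in X x j i, l \in codom u]].
  pose Agr := [set v : hole | [forall l, (l \in X x j i) ==> (v l == y x j (i, l))]].
  have -> : [set w | ok x j i w] = setX Hit Agr by apply/setP => w; rewrite !inE.
  rewrite cardsX cW expnMn (mulnC (2 ^ #|X x j i|)) mulnACA.
  by rewrite (card_agree (X x j i) (fun l => y x j (i, l))) leq_mul2r card_hit ?orbT.
have [|||||w Hw] := @exists_satisfying_all 'I_m W J ((2 * k) ^ s) L
    (fun x j => pigeons (residual U (A x) (T x j))) ok => //.
- by rewrite expn_gt0 muln_gt0 k0.
- move=> x j.
  have k0' : (0 < 2 * k)%N by rewrite muln_gt0 k0.
  apply: (@le_trans _ _ (\prod_(i in pigeons (residual U (A x) (T x j)))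
     ((2 * k) ^ #|X x j i|)%:R^-1)%R); last first.
    apply: ler_prod => i _; rewrite invr_ge0 ler0n /=.
    rewrite ler_pdivlMr ?ltr0n // mulrC ler_pdivrMr ?ltr0n ?expn_gt0 ?k0' //.
    by rewrite -natrM ler_nat.
  rewrite prodfV -natr_prod -expn_sum lef_pV2 ?posrE ?ltr0n ?expn_gt0 ?k0' //.
  by rewrite ler_nat leq_pexp2l.
pose U' := U :|: [set v : V | v.2 \in codom (w v.1).1].
pose b' v := if v \in U then b v else (w v.1).2 v.2.
exists U', b'; split.
- exact: subsetUl.
- by move=> v vU; rewrite /b' vU.
- move=> i; apply: leq_trans (_ : #|row_of U i :|: [set l in codom (w i).1]| <= _).
    by apply/subset_leq_card/subsetP => l; rewrite !inE.
  apply: leq_trans (leq_card_setU _ _) _; rewrite leq_add2l cardsE.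
  by apply: leq_trans (card_size _) _; rewrite size_codom card_ord.
move=> x; have [j Hj] := Hw x; exists j => z [zU zA]; apply/sat_termP => l lT.
have [yU yA] := ext_y x j; have /sat_termP/(_ _ lT) <- := sat_y x j.
have [lU|lU] := boolP (l.1 \in U).
  rewrite -(yU _ lU) -zU; last by rewrite inE lU.
  by rewrite /b' lU.
have [lA|lA] := boolP (l.1.1 \in A x).
  by rewrite -(yA l.1) ?inE // -(zA l.1) // inE.
have lR : l \in residual U (A x) (T x j) by rewrite inE lT lU lA.
have lX : l.1.2 \in X x j l.1.1.
  by rewrite inE -surjective_pairing; apply: imset_f.
have /andP[/forall_inP/(_ _ lX) h1 /forallP/(_ l.1.2)] := Hj _ (imset_f (fun l : V * bool => l.1.1) lR).
rewrite lX /= -surjective_pairing => /eqP <-.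
rewrite -zU; first by rewrite /b' (negPf lU).
by rewrite !inE h1 orbT.
Qed.

End Pigeons.

Arguments cols {m k} A.

(** * Switching *)

Section Switching.
Variables m k s : nat.
Local Notation V := ('I_m * 'I_k)%type.
Local Notation hole := {ffun 'I_k -> bool}.

(* A round on [2 ^ L] nodes needs families of [(2k)^s * L.+1] disjoint terms, so
   a cover has [s] times as many pigeons, with [2 ^ k] holes each: thus [L.+1] is
   multiplied by [growth]. *)
Definition growth := 1 + k * s * (2 * k) ^ s.

(** Each pigeon placed adds [k] to [L], so the total increase of [L] over [r] rounds, which is this
    number, bounds the number of pigeons placed. *)
Definition depth r L := L.+1 * (growth ^ r).-1.

Lemma depth_step r L : 0 < k ->
  s * ((2 * k) ^ s * L.+1) + depth r (L + k * (s * ((2 * k) ^ s * L.+1)))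
    <= depth r.+1 L.
Proof.
move=> k_gt0; rewrite /depth expnS; have : 0 < growth ^ r by rewrite expn_gt0.
rewrite /growth; set q := (2 * k) ^ s; case: ((1 + k * s * q) ^ r) => // y _; rewrite [y.+1.-1]/=.
have -> : ((1 + k * s * q) * y.+1).-1 = (1 + k * s * q) * y + k * (s * q) by lia.
have -> : (L + k * (s * (q * L.+1))).+1 = L.+1 * (1 + k * s * q) by lia.
have : s * (q * L.+1) <= L.+1 * (k * (s * q)).
  by rewrite mulnA mulnC leq_mul2l /= leq_pmull.
lia.
Qed.

(* Nodes with many disjoint alive terms become true; any other node has a small
   set of pigeons covering its alive terms, and is replaced by one child for
   each placement of these pigeons, where the residuals are shorter. *)
Lemma switching r : 0 < k -> r <= s ->
  forall (J : finType) (A : J -> {set 'I_m}) (g : J -> V -> bool)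
    (D : J -> dnf V) (U : {set V}) (b : V -> bool) (t L M : nat),
  #|J| <= 2 ^ L -> (forall i, #|row_of U i| <= t) ->
  (forall x T, alive U b (A x) (g x) (D x) T -> #|residual U (A x) T| <= r) ->
  M <= 2 ^ (k - (t + s * r)) ->
  exists (U' : {set V}) b', [/\ U \subset U', agree U b b',
    forall i, #|row_of U' i| <= t + s * r &
    forall x, determined M (depth r L) U' b' (A x) (g x) (D x)].
Proof.
move=> k_gt0; elim: r => [|r IH] rs J A g D U b t L M cJ rowU res_r Mt.
  exists U, b; split=> //; first by move=> i; rewrite muln0 addn0.
  move=> x P g1 _ ext1 mP _; exists set0, g1.
  rewrite cards0 !setU0; split=> //.
    by split=> //; case: ext1.
  have ext y : extends U b (A x) g1 y -> extends U b (A x) (g x) y.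
    by apply: extendsW => //; case: ext1.
  (* Residuals of alive terms are empty here, so a term satisfied by one completion is satisfied by
     all. *)
  have [[y ey]|no] := EM (exists2 y, extends U b (A x) g1 y & sat_dnf y (D x)); last first.
    by right=> y ey; apply/negP => sy; apply: no; exists y.
  move=> /existsP[T /andP[TD sT]]; left=> z ez; apply/existsP; exists T.
  rewrite TD /=; apply/sat_termP => l lT; have /sat_termP/(_ _ lT) <- := sT.
  have : #|residual U (A x) T| <= 0.
    by apply: res_r; split=> //; exists y => //; apply: ext.
  rewrite leqn0 cards_eq0 => /eqP/setP/(_ l); rewrite !inE lT /= => /negbT.
  case: ey ez => [yU yA] [zU zA]; rewrite negb_and !negbK => /orP[lU|lA].
    by rewrite -yU // -zU.
  by rewrite -(yA l.1) ?inE // -(zA l.1) // inE.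
pose q := (2 * k) ^ s; pose c := q * L.+1; pose d := s * c.
pose many x := exists T : nat -> term V,
  (forall j, j < c -> alive U b (A x) (g x) (D x) (T j)) /\
  (forall j j', j < j' < c ->
     [disjoint pigeons (residual U (A x) (T j))
      & pigeons (residual U (A x) (T j'))]).
pose K := [set x | `[< many x >]].
have [U1 [b1 [sU1 bb1 rowU1 satK]]] : exists (U1 : {set V}) b1, [/\ U \subset U1, agree U b b1,
    forall i, #|row_of U1 i| <= #|row_of U i| + s &
    forall x, x \in K -> forall z,
      extends U1 b1 (A x) (g x) z -> sat_dnf z (D x)].
  pose J' : finType := {x | x \in K}.
  have cJ' : #|J'| <= 2 ^ L by rewrite card_sig; apply: leq_trans (max_card _) cJ.
  have /fin_all_exists[T HT] : forall x : J', exists T : nat -> term V,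
      (forall j, j < c -> alive U b (A (val x)) (g (val x)) (D (val x)) (T j)) /\
      (forall j j', j < j' < c ->
         [disjoint pigeons (residual U (A (val x)) (T j))
         & pigeons (residual U (A (val x)) (T j'))]).
    by case=> x /=; rewrite inE => /asboolP.
  have /fin_all_exists[y Hy] : forall p : J' * 'I_c, exists y,
      extends U b (A (val p.1)) (g (val p.1)) y /\ sat_term y (T p.1 p.2).
    case=> x j /=; have [/(_ _ (ltn_ord j))[_ [y ey sy]] _] := HT x.
    by exists y.
  have [||||||U1 [b1 [sU1 bb1 rowU1 HU1]]] := @satisfy_disjoint_terms m k J' (fun x => A (val x))
    (fun x => g (val x)) U b s L (fun x j => T x j) (fun x j => y (x, j)) => //.
  - by move=> x j; case: (Hy (x, j)).
  - by move=> x j; case: (Hy (x, j)).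
  - move=> x j; have [/(_ _ (ltn_ord j)) /res_r h _] := HT x; exact: leq_trans h rs.
  - move=> x j j' jj'; have [_ dT] := HT x.
    have [lt|lt|/ord_inj e] := ltngtP j j'; last by rewrite e eqxx in jj'.
      by apply: dT; rewrite lt /=.
    by rewrite disjoint_sym; apply: dT; rewrite lt /=.
  exists U1, b1; split=> // x xK z ez.
  have [j Hj] := HU1 (Sub x xK : J').
  apply/existsP; exists (T (Sub x xK) j); rewrite (Hj z ez) andbT.
  by have [/(_ _ (ltn_ord j))[]] := HT (Sub x xK).
have /fin_all_exists[Q HQ] : forall x, exists Q : {set 'I_m}, #|Q| <= d /\
    (x \notin K -> forall T, alive U b (A x) (g x) (D x) T ->
     ~~ [disjoint pigeons (residual U (A x) T) & Q]).
  move=> x; have res_s T : alive U b (A x) (g x) (D x) T -> #|residual U (A x) T| <= s.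
    by move=> /res_r h; exact: leq_trans h rs.
  have [H|[Q [cQ cov]]] := disjoint_or_cover res_s c; last by exists Q.
  by exists set0; rewrite cards0; split=> //; rewrite inE => /asboolP.
(* A child of [x] is a list of [d] holes, the [j]-th being for the [j]-th pigeon of [enum (Q x)].
   Lists with repeated holes are kept, which only enlarges the union bound. *)
pose A1 (p : J * {ffun 'I_d -> hole}) := A p.1 :|: Q p.1.
pose g1 (p : J * {ffun 'I_d -> hole}) (v : V) :=
  if v.1 \in A p.1 then g p.1 v
  else if insub (index v.1 (enum (Q p.1))) is Some j then p.2 j v.2 else false.
(* Nodes of [K] are already true; their children get the empty DNF. *)
pose D1 (p : J * {ffun 'I_d -> hole}) := if p.1 \in K then set0 else D p.1.
have agree_g1 p : agree (cols (A p.1)) (g p.1) (g1 p).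
  by move=> v; rewrite inE /g1 => ->.
have cJ1 : #|{: J * {ffun 'I_d -> hole}}| <= 2 ^ (L + k * d).
  by rewrite card_prod !card_ffun !card_ord card_bool expnD expnM leq_mul2r cJ orbT.
have rU1 i : #|row_of U1 i| <= t + s.
  by apply: leq_trans (rowU1 i) _; rewrite leq_add2r.
have Mt1 : M <= 2 ^ (k - (t + s + s * r)) by rewrite -addnA -mulnS.
have res1 p T : alive U1 b1 (A1 p) (g1 p) (D1 p) T ->
    #|residual U1 (A1 p) T| <= r.
  case; rewrite /D1; case: ifP => [_|/negbT pK]; first by rewrite inE.
  move=> TD [y ey sy]; have aT : alive U b (A p.1) (g p.1) (D p.1) T.
    by split=> //; exists y => //; apply: extendsW ey => //; apply: subsetUl.
  (* The cover meets a pigeon of the old residual; placing that pigeon removes a literal, so the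
     inclusion of residuals is strict. *)
  rewrite -ltnS; apply: leq_trans (res_r _ _ aT); apply: proper_card.
  rewrite properE residualS ?subsetUl //=.
  have /pred0Pn[i /andP[/imsetP[l lR ->] lQ]] := (HQ p.1).2 pK _ aT.
  by apply/subsetPn; exists l => //; rewrite !inE (lQ : l.1.1 \in Q p.1) orbT !andbF.
have [U2 [b2 [sU2 bb2 rowU2 det2]]] := IH (ltnW rs) _ A1 g1 D1 U1 b1 (t + s) _ M cJ1 rU1 res1 Mt1.
have sU : U \subset U2 by apply: subset_trans sU1 sU2.
exists U2, b2; split=> //.
- exact: agree_trans bb1 (agreeS sU1 bb2).
- by move=> i; rewrite mulnS addnA.
move=> x P y AP [yU yA] mP PM.
have [xK|xK] := boolP (x \in K).
  exists set0, y; rewrite cards0 !setU0; split=> //; left=> z ez.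
  by apply: satK => //; apply: extendsW ez.
have dh : d + depth r (L + k * d) <= depth r.+1 L.
  exact: depth_step.
have [cQ _] := HQ x.
have [||||y1 [[y1U y1P] m1]] := @extend_matching m k (t + s + s * r) U2 b2 P (Q x) y => //.
  by apply: leq_trans Mt1; lia.
have APQ : A x :|: Q x \subset P :|: Q x by apply: setSU.
(* The adversary's matching, once extended to [Q x], selects the child that records the holes it
   gives to these pigeons. *)
pose w : {ffun 'I_d -> hole} :=
  [ffun j : 'I_d => [ffun l => if [pick i | (i \in Q x) && (index i (enum (Q x)) == j)] is Some i
                then y1 (i, l) else false]].
have g1y1 : agree (cols (A x :|: Q x)) (g1 (x, w)) y1.
  move=> [i l]; rewrite /g1 !inE /=; case: ifP => [iA _|_ /= iQ].
    rewrite yA ?inE // y1P // inE; exact: (subsetP AP).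
  have id : index i (enum (Q x)) < d.
    by apply: leq_trans cQ; rewrite cardE index_mem mem_enum.
  rewrite insubT /= !ffunE; case: pickP => [i' /andP[i'Q /eqP]|/(_ i)]; last by rewrite iQ eqxx.
  by move/(congr1 (nth i (enum (Q x)))); rewrite !nth_index ?mem_enum // => ->.
have [||||E [y2 [cE [y2U y2P] m2 dec]]] := det2 (x, w) (P :|: Q x) y1 => //.
  have := (leq_card_setU P (Q x)).1; lia.
exists (Q x :|: E), y2; split.
- have := (leq_card_setU (Q x) E).1; lia.
- by split=> //; apply: agree_trans y1P (agreeS _ y2P); apply/colsS/subsetUl.
- by rewrite setUA.
by move: dec; rewrite /D1 (negPf xK) /A1 /= setUA.
Qed.
End Switching.

(** * Soundness against matchings *)

Lemma sat_dnfU (V : finType) (y : V -> bool) (D1 D2 : dnf V) :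
  sat_dnf y (D1 :|: D2) = sat_dnf y D1 || sat_dnf y D2.
Proof.
apply/existsP/orP => [[T /andP[/setUP[TD|TD] sT]]|[]/existsP[T /andP[TD sT]]].
- by left; apply/existsP; exists T; rewrite TD.
- by right; apply/existsP; exists T; rewrite TD.
- by exists T; rewrite inE TD.
- by exists T; rewrite inE TD orbT.
Qed.

Lemma sat_dnf1 (V : finType) (y : V -> bool) (T : term V) :
  sat_dnf y [set T] = sat_term y T.
Proof.
apply/existsP/idP => [[T' /andP[/set1P ->]]//|sT]; exists T.
by rewrite set11.
Qed.

Lemma sat_termU (V : finType) (y : V -> bool) (T1 T2 : term V) :
  sat_term y (T1 :|: T2) = sat_term y T1 && sat_term y T2.
Proof.
apply/sat_termP/andP => [h|[/sat_termP h1 /sat_termP h2] l /setUP[/h1|/h2] //].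
by split; apply/sat_termP => l lT; apply: h; rewrite inE lT ?orbT.
Qed.

Lemma sat_disj (V : finType) (y : V -> bool) (J : {set V * bool}) :
  sat_dnf y (disj J) -> exists2 l, l \in J & y l.1 = l.2.
Proof.
case/existsP=> _ /andP[/imsetP[l lJ ->] /sat_termP/(_ l (set11 l)) yl].
by exists l.
Qed.

Lemma disj_sat (V : finType) (y : V -> bool) (J : {set V * bool}) l :
  l \in J -> y l.1 = l.2 -> sat_dnf y (disj J).
Proof.
move=> lJ yl; apply/existsP; exists [set l]; rewrite imset_f //=.
by apply/sat_termP => _ /set1P ->.
Qed.

(** One-premise rules repeat their premise, so that all rules are treated alike. *)
Lemma res_rule_sound (V : finType) s (avail : pred (dnf V)) D :
  res_rule s avail D -> exists D1 D2, [/\ avail D1, avail D2 &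
    forall y, sat_dnf y D1 -> sat_dnf y D2 -> sat_dnf y D].
Proof.
case=> [D1 D2 J1 J2 a1 a2 _|D1 D2 J a1 a2|D' J a _|D' J1 J2 a].
- exists (D1 :|: [set J1]), (D2 :|: [set J2]); split=> // y.
  rewrite !sat_dnfU !sat_dnf1 sat_termU.
  by case: (sat_dnf y D1); case: (sat_dnf y D2)=> //=; case: sat_term => //=; case: sat_term.
- exists (D1 :|: disj J), (D2 :|: [set @neg V @: J]); split=> // y.
  rewrite !sat_dnfU sat_dnf1 => /orP[->//|/sat_disj[l lJ yl]] /orP[->|]; first by rewrite orbT.
  by move/sat_termP/(_ _ (imset_f _ lJ)) => /=; rewrite yl; case: l.2.
- by exists D', D'; split=> // y; rewrite sat_dnfU => ->.
exists (D' :|: [set J1 :|: J2]), (D' :|: [set J1 :|: J2]); split=> // y.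
by rewrite !sat_dnfU !sat_dnf1 sat_termU => /orP[->//|/andP[->]]; rewrite orbT.
Qed.

(** A clause is false only if both of its pigeons sit in hole [a], which no matching on the two
    allows. *)
Lemma binphp_sat m k (C : {set ('I_m * 'I_k) * bool}) : C \in binphp m k ->
  exists i i', forall g, matching [set i; i'] g -> sat_dnf g (disj C).
Proof.
rewrite inE => /existsP[i /existsP[i' /existsP[a /andP[ii' /eqP ->]]]].
exists i, i' => g mg.
have : hole_of g i != hole_of g i'.
  by apply: contra_neq ii'; apply: mg; rewrite !inE eqxx ?orbT.
have [l nl|al] := pickP (fun l => (g (i, l) != bit a l) || (g (i', l) != bit a l)).
  case/orP: nl => [nl _|nl _].
    apply: (@disj_sat _ _ _ ((i, l), ~~ bit a l)) => /=.
      by rewrite inE imset_f.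
    by move: nl; case: (g _); case: bit.
  apply: (@disj_sat _ _ _ ((i', l), ~~ bit a l)) => /=.
    by rewrite inE imset_f ?orbT.
  by move: nl; case: (g _); case: bit.
case/eqP; apply/ffunP => l; rewrite !ffunE.
by have /negbT := al l; rewrite negb_or !negbK => /andP[/eqP -> /eqP ->].
Qed.

Lemma refutation_large m k s L (pi : seq (dnf ('I_m * 'I_k)%type)) :
  0 < k -> res_refutation s (binphp m k) pi -> size pi <= 2 ^ L ->
  2 ^ (k - s * s) < 3 * depth k s s L + 4.
Proof.
move=> k0 [steps sdnf last] piL; rewrite ltnNge; apply/negP => hM.
set h := depth k s s L in hM; set M := 2 ^ (k - s * s) in hM.
have [||||U [b [_ _ rowU det]]] := @switching m k s s k0 (leqnn s)
    'I_(size pi) (fun=> set0) (fun _ _ => false) (fun j => nth set0 pi j)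
    set0 (fun=> false) 0 L M => //.
- by rewrite card_ord.
- move=> i; rewrite leqn0 cards_eq0; apply/eqP/setP => l; by rewrite !inE.
- move=> x T [TD _]; apply: leq_trans (_ : #|T| <= s).
    by apply/subset_leq_card/subsetP => l; rewrite inE => /andP[].
  have /forall_inP := allP sdnf _ (mem_nth set0 (ltn_ord x)); exact.
have ext_refl (P : {set 'I_m}) g : agree U b g -> extends U b P g g by split.
(* The allowance [h + 2] covers both the [h] pigeons deciding a line and the 2 pigeons of a clause.
   A refuting matching of [h] pigeons, extended for one premise and then for the other, has at most
   [3h + 4] pigeons. *)
pose forced D := forall (P : {set 'I_m}) g, agree U b g -> matching P g ->
  #|P| <= h + h.+2 -> exists (P' : {set 'I_m}) g',
  [/\ P \subset P', #|P'| <= #|P| + h.+2, extends U b P g g', matching P' g' &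
    forall y, extends U b P' g' y -> sat_dnf y D].
have forced_axiom C : C \in binphp m k -> forced (disj C).
  move=> /binphp_sat[i [i' HC]] P g bg mP cP.
  have c2 : #|[set i; i']| <= 2 by rewrite cards2; case: (_ != _).
  have [|g' [eg mg]] := extend_matching (Q := [set i; i']) rowU _ bg mP.
    by rewrite add0n; apply: leq_trans hM; lia.
  exists (P :|: [set i; i']), g'; split=> //; first exact: subsetUl.
    have := (leq_card_setU P [set i; i']).1; lia.
  move=> y [_ gy]; apply: HC => j j' jC j'C.
  have inP x : x \in [set i; i'] -> x \in P :|: [set i; i'].
    by apply/subsetP/subsetUr.
  by rewrite -!(hole_of_agree gy) ?inP //; apply: mg; apply: inP.
(* A line refuted by a small matching would, after extending the matching until
   both premises are true, contradict the soundness of the rule. *)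
pose refuted D := exists (E : {set 'I_m}) g, [/\ #|E| <= h, agree U b g, matching E g &
  forall y, extends U b E g y -> ~~ sat_dnf y D].
(* The decision depends on [E] alone: a false outcome would make [E], without [P], a refuting
   matching of at most [h] pigeons. *)
have forced_line j : j < size pi -> ~ refuted (nth set0 pi j) -> forced (nth set0 pi j).
  move=> jpi nref P g bg mP cP.
  have [||||E [g' [cE eg mE dec]]] := det (Ordinal jpi) P g => //.
  - exact: sub0set.
  - by split=> // v; rewrite !inE.
  - lia.
  exists (P :|: E), g'; split=> //; first exact: subsetUl.
    have := (leq_card_setU P E).1; lia.
  have sub y : extends U b (P :|: E) g' y -> extends U b (set0 :|: E) g' y.
    by apply: extendsW => //; rewrite set0U subsetUr.
  case: dec => [sat y /sub /sat //|uns]; case: nref; exists E, g'; split=> //.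
  - by case: eg.
  - by move=> i i' iE i'E; apply: mE; rewrite inE ?iE ?i'E orbT.
  by move=> y ey; apply: uns; rewrite set0U.
have avail_forced j : (forall i, i < j -> i < size pi -> forced (nth set0 pi i)) ->
    forall D, available (binphp m k) (take j pi) D -> forced D.
  move=> IH D /orP[/imsetP[C CF ->]|]; first exact: forced_axiom.
  move/(nthP set0) => [i]; rewrite size_take_min leq_min => /andP[ij ipi] <-.
  by rewrite nth_take //; apply: IH.
have all_forced j : j < size pi -> forced (nth set0 pi j).
  have [n] := ubnP j; elim: n j => // n IH j jn jpi.
  apply: forced_line => // -[E [g [cE bg mE uns]]].
  have av := avail_forced j (fun i ij ip => IH i (leq_trans ij jn) ip).
  have [D1 [D2 [a1 a2 snd]]] := res_rule_sound (steps j jpi).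
  have [|P1 [g1 [sP1 cP1 [bg1 gg1] m1 s1]]] := av _ a1 E g bg mE; first by lia.
  have [|P2 [g2 [sP2 cP2 [bg2 gg2] m2 s2]]] := av _ a2 P1 g1 bg1 m1; first by lia.
  have e2 := ext_refl P2 g2 bg2.
  have e1 : extends U b P1 g1 g2 by split.
  have e0 : extends U b E g g2.
    by split=> //; apply: agree_trans gg1 (agreeS _ gg2); apply: colsS.
  by have := uns _ e0; rewrite (snd _ (s1 _ e1) (s2 _ e2)).
have fin : forced set0.
  apply: (avail_forced (size pi)); last by rewrite take_size.
  by move=> i _; apply: all_forced.
have [||P [g [_ _ [bg _] _ sg]]] := fin set0 b (fun _ _ => erefl _); last first.
- by have /existsP[T] := sg _ (ext_refl P g bg); rewrite inE.
- by rewrite cards0.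
- by move=> i i'; rewrite inE.
Qed.

(** * Asymptotics *)

(** Exponent lost from [k]: [s * s] for the bits set, 2 for the constants in [3 * depth + 4], and
    the rest for [growth ^ s] when [2 * k <= 2 ^ a]. *)
Definition loss a s := s * s + 2 + a * (s * s.+2).

Lemma refutation_log_size m k s a L (pi : seq (dnf ('I_m * 'I_k)%type)) :
  0 < k -> s <= k -> 2 * k <= 2 ^ a ->
  res_refutation s (binphp m k) pi -> size pi <= 2 ^ L ->
  2 ^ k < 2 ^ loss a s * L.+1.
Proof.
move=> k0 sk ka ref /(refutation_large k0 ref) lb.
have growth_le : growth k s <= (2 * k) ^ s.+2.
  rewrite /growth !expnS; have q0 : 0 < (2 * k) ^ s by rewrite expn_gt0 muln_gt0 k0.
  have : k * s * (2 * k) ^ s <= k * k * (2 * k) ^ s.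
    by rewrite leq_mul2r leq_mul2l sk !orbT.
  have : 1 <= k * k * (2 * k) ^ s by rewrite !muln_gt0 k0 q0.
  lia.
have mono x y e : x <= y -> x ^ e <= y ^ e by case: e => // e; rewrite leq_exp2r.
have growth_exp : growth k s ^ s <= 2 ^ (a * (s * s.+2)).
  apply: leq_trans (mono _ _ s growth_le) _.
  by rewrite -expnM (expnM 2 a) [s * _]mulnC; apply: mono.
have k_split : 2 ^ k <= 2 ^ (s * s) * 2 ^ (k - s * s).
  by rewrite -expnD leq_exp2l //; lia.
apply: leq_ltn_trans k_split _; rewrite /loss 2!expnD -!mulnA ltn_pmul2l ?expn_gt0 //.
apply: leq_trans lb _; rewrite /depth.
have : 0 < growth k s ^ s by rewrite expn_gt0.
have : L.+1 * growth k s ^ s <= L.+1 * 2 ^ (a * (s * s.+2)) by rewrite leq_mul2l growth_exp orbT.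
move: (growth k s ^ s) (2 ^ (a * (s * s.+2))) => [//|y] z /=.
lia.
Qed.

(* Imported only here: the set notations of classical_sets clash with those of
   finset. *)
From mathcomp Require Import all_classical all_reals all_analysis.

Local Open Scope ring_scope.

(** With [t] the logarithm, [k^e >= 2^(te) = exp(te ln 2) >= te ln 2]. *)
Lemma trunc_log2_le_powR (R : realType) (e : R) (k : nat) : 0 < e -> (0 < k)%N ->
  (trunc_log 2 k)%:R <= (e * ln 2)^-1 * k%:R `^ e.
Proof.
move=> e0 k0; have l2 : 0 < ln (2 : R) by rewrite ln_gt0 // ltr1n.
have el0 : 0 < e * ln 2 by rewrite mulr_gt0.
rewrite mulrC ler_pdivlMr //.
apply: (@le_trans _ _ ((2 ^+ trunc_log 2 k) `^ e)).
  rewrite -powR_mulrn // -powRrM /powR gt_eqF //.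
  apply: le_trans (expR_ge1Dx _); rewrite mulrA; lra.
by rewrite ge0_ler_powR ?nnegrE ?(ltW e0) ?ler0n ?exprn_ge0 // -natrX ler_nat trunc_logP.
Qed.

Lemma loss_sublinear (R : realType) (lambda delta : R) : 0 < lambda -> 0 < delta ->
  exists K : nat, forall k s : nat, (K <= k)%N ->
    `| s%:R - Num.sqrt 2 * k%:R `^ (1 / (2 + lambda)) | < 1 ->
    (loss (trunc_log 2 k).+2 s)%:R <= delta * k%:R.
Proof.
(* [e] is chosen so that [k = x^2 w^2] with [x = k^(1/(2+lambda))] and [w = k^e]: [x^2] accounts for
   [s^2], one [w] absorbs the logarithm, and the other exceeds [B], hence every constant. Here 26 is
   9 + 2 + 15, from [s <= 3x]. *)
move=> l0 d0; pose e := lambda / (2 + lambda) / 2.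
have l2 : 0 < 2 + lambda by rewrite addr_gt0.
have e0 : 0 < e by rewrite !divr_gt0.
pose C : R := (e * ln 2)^-1 + 2; pose B := 26 * C / delta.
have C0 : 0 < C by rewrite addr_gt0 // invr_gt0 mulr_gt0 // ln_gt0 // ltr1n.
have B0 : 0 < B by rewrite divr_gt0 // mulr_gt0.
exists (maxn 1 (Num.bound (B `^ e^-1))) => k s.
rewrite geq_max => /andP[k1 kB] hs.
have kR1 : 1 <= k%:R :> R by rewrite ler1n.
pose x := k%:R `^ (1 / (2 + lambda)); pose w := k%:R `^ e.
have wB : B <= w.
  rewrite -[leLHS](powRr1 (ltW B0)) -(mulVf (lt0r_neq0 e0)) powRrM.
  rewrite ge0_ler_powR ?nnegrE ?(ltW e0) ?powR_ge0 ?ler0n //.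
  apply: le_trans (ltW (archi_boundP (powR_ge0 _ _))) _.
  by rewrite ler_nat.
have x1 : 1 <= x by rewrite -[leLHS](powRr0 k%:R) ler_powR // divr_ge0 // ltW.
have w1 : 1 <= w by rewrite -[leLHS](powRr0 k%:R) ler_powR // ltW.
have xw : x * x * (w * w) = k%:R.
  have kn0 : k%:R != 0 :> R by rewrite pnatr_eq0 -lt0n.
  rewrite -!powRD ?kn0 ?implybT // -[RHS](powRr1 (ler0n _ k)); congr (_ `^ _).
  by rewrite /e; field; rewrite gt_eqF.
have s3 : s%:R <= 3 * x.
  have sq2 : Num.sqrt 2 <= 2 :> R.
    by rewrite -[leRHS]ger0_norm // -sqrtr_sqr ler_wsqrtr // expr2; lra.
  have : Num.sqrt 2 * x <= 2 * x by rewrite ler_wpM2r // (le_trans _ x1).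
  by move: hs; rewrite -/x ltr_norml => /andP[_]; lra.
have aC : (trunc_log 2 k).+2%:R <= C * w.
  have := trunc_log2_le_powR e0 k1; rewrite -/w /C -addn2 natrD mulrDl; lra.
have a0 : (0 < (trunc_log 2 k).+2)%N by [].
move: (trunc_log 2 k).+2 a0 aC => a a0 aC.
rewrite /loss !natrD !natrM -[s.+2%:R]natr1 -[s.+1%:R]natr1.
set A : R := a%:R in aC *.
have A1 : 1 <= A by rewrite ler1n.
have s0 : 0 <= s%:R :> R by rewrite ler0n.
have ss : s%:R * s%:R <= 9 * (x * x) by nra.
have ss2 : s%:R * (s%:R + 1 + 1) <= 15 * (x * x) by nra.
have xx1 : 1 <= x * x by nra.
have : s%:R * s%:R + 2 + A * (s%:R * (s%:R + 1 + 1)) <= 26 * (A * (x * x)) by nra.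
move/le_trans; apply.
have Bw : 26 * C <= delta * w by rewrite (mulrC delta) -ler_pdivrMr.
rewrite -xw; apply: le_trans (_ : 26 * (C * w * (x * x)) <= _).
  by rewrite ler_pM2l // ler_wpM2r //; lra.
have : 26 * C * (w * (x * x)) <= delta * w * (w * (x * x)).
  by rewrite ler_wpM2r //; nra.
lra.
Qed.

(* n = 2 ^ k, so k = log n; s is an integer rounding of
   sqrt 2 * (log n) ^ (1 / (2 + lambda)). *)
Theorem theorem4p8 (R : realType) (lambda mu : R) :
  0 < lambda -> 0 < mu ->
  exists (c : R) (N : nat), 0 < c /\
    forall n k m s : nat,
      n = (2 ^ k)%N -> (N <= n)%N -> (n < m)%N ->
      `| s%:R - Num.sqrt 2 * k%:R `^ (1 / (2 + lambda)) | < 1 ->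
      forall pi : seq (dnf ('I_m * 'I_k)%type),
        res_refutation s (binphp m k) pi ->
        2 `^ (c * n%:R `^ (1 - mu)) <= (size pi)%:R.
Proof.
(* The cap 1/2 on [delta] gives [Y >= 2^(k/2) >= 4] for [k >= 4]. Then [L + 1 >= 4], so
   [L - 1 >= (L + 1)/2 > Y/2], whence [c = 1/2]. *)
move=> l0 m0; pose delta := Num.min mu 2^-1.
have d0 : 0 < delta by rewrite lt_min m0 invr_gt0 ltr0n.
have [K HK] := loss_sublinear l0 d0.
exists 2^-1, (2 ^ maxn K 4)%N; split; first by rewrite invr_gt0.
move=> n k m s -> ; rewrite leq_exp2l // geq_max => /andP[Kk k4] _ hs pi ref.
have lossk := HK k s Kk hs; set a := (trunc_log 2 k).+2 in lossk.
have dmu : delta <= mu by rewrite ge_min lexx.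
have dhalf : delta <= 2^-1 by rewrite ge_min lexx orbT.
have k0 : (0 < k)%N by apply: leq_trans k4.
have k4R : 4 <= k%:R :> R by rewrite ler_nat.
have sk : (s <= k)%N.
  rewrite -(ler_nat R); apply: (@le_trans _ _ (loss a s)%:R).
    by rewrite ler_nat /loss; nia.
  apply: le_trans lossk _; nra.
have ka : (2 * k <= 2 ^ a)%N.
  by rewrite /a expnS leq_mul2l /= ltnW // trunc_log_ltn.
set S := size pi; have SL : (S <= 2 ^ up_log 2 S)%N by apply: up_logP.
set L := up_log 2 S in SL.
have := refutation_log_size k0 sk ka ref SL.
rewrite -(ltr_nat R) natrM !natrX => lb.
pose Y : R := 2 `^ ((1 - delta) * k%:R).
have YL : Y < L.+1%:R.
  have p0 : 0 < 2 `^ (delta * k%:R) :> R by rewrite powR_gt0.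
  rewrite -(ltr_pM2l p0) /Y -powRD ?pnatr_eq0 ?implybT // -mulrDl addrCA subrr addr0 mul1r.
  rewrite powR_mulrn //; apply: lt_le_trans lb _.
  by rewrite ler_wpM2r ?ler0n // -powR_mulrn // ler_powR // ler1n.
have Y4 : 4 <= Y.
  have -> : 4 = 2 `^ 2%:R :> R by rewrite powR_mulrn // expr2; lra.
  by rewrite ler_powR ?ler1n //; nra.
have L3 : (3 < L.+1)%N by rewrite -(ltr_nat R); lra.
have S1 : (1 < S)%N.
  by rewrite ltnNge; apply/negP => S1; move: L3; rewrite /L; case: (S) S1 => [|[|]].
have /andP[LS _] := up_log_bounds (isT : (1 < 2)%N) S1.
apply: (@le_trans _ _ (2 ^ L.-1)%:R); last by rewrite ler_nat ltnW.
rewrite !natrX -[leRHS]powR_mulrn // ler_powR ?ler1n //.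
have nY : (2 ^+ k) `^ (1 - mu) <= Y.
  rewrite -powR_mulrn // -powRrM /Y mulrC ler_powR ?ler1n // ler_wpM2r ?ler0n //; lra.
have -> : L.-1%:R = L.+1%:R - 2 :> R.
  by rewrite -natrB; [congr _%:R; lia | lia].
have : 4 <= L.+1%:R :> R by rewrite ler_nat.
lra.
Qed.
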